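(* Let $\lambda > 0$ and let $Q$ be a set of $\alpha d$ points of $\mathbb{R}^d$, where $\alpha > 1$, such that its convex hull $\operatorname{conv} Q$ contains the ball $\lambda \mathbf{B}^d$. Then there are at most $2d$ points of $Q$ whose convex hull $Q'$ satisfies \[ \frac{\lambda}{5\alpha d}\,\mathbf{B}^d \subset Q'. \]
   Context: $\mathbf{B}^d$ denotes the standard closed Euclidean unit ball in $\mathbb{R}^d$ centered at the origin, and $t\,\mathbf{B}^d$ is its dilate by the factor $t$. Here $d$ is a positive integer and $\alpha$ is a real number such that $\alpha d$ is an integer (it is the number of points of $Q$). *)

(* Defs.v *)
From mathcomp Require Export all_boot all_order all_algebra finmap.
From mathcomp Require Export boolp classical_sets reals convex.

Set Implicit Arguments.
Unset Strict Implicit.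
Unset Printing Implicit Defensive.

Import GRing.Theory Num.Theory.

Local Open Scope classical_set_scope.
Local Open Scope ring_scope.

(* The norm that mathcomp-analysis puts on 'rV[R]_d is the max norm, hence an
   explicit Euclidean norm. *)
Definition enorm (R : realType) (d : nat) (x : 'rV[R]_d) : R :=
  Num.sqrt (\sum_(i < d) x ord0 i ^+ 2).

Definition unit_ball (R : realType) (d : nat) : set 'rV[R]_d :=
  [set x | enorm x <= 1].

Definition dilate (R : realType) (d : nat) (t : R) (A : set 'rV[R]_d) :
    set 'rV[R]_d :=
  [set t *: x | x in A].

Definition convex_hull (R : realType) (d : nat) (A : set 'rV[R]_d) :
    set 'rV[R]_d :=
  smallest (@convex_set R 'rV[R]_d) A.

(* Main.v *)
Require Import Defs.
From mathcomp Require Import zify lra ring interval_inference.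
From mathcomp Require Import topology normedtype derive.

(** Write q_1, ..., q_N for the points of Q, so that N = alpha * d, and let r
    stand for the radius lambda of the given ball.

    The points are first replaced by positive multiples of themselves that are
    balanced.  The polar polytope {c | <c, q_i> <= 1 for all i} is compact,
    because the hull of the q_i contains a ball; the maximiser c over it of the
    product of the slacks 1 - <c, q_i> has positive slacks, and the vanishing of
    the logarithmic derivative of that product says exactly that the vectors
    w_i = q_i / (1 - <c, q_i>) sum to zero ([analytic_center]).  In polar terms,
    the w_i are the vertices of the polar of the polytope recentred at c.

    For vectors with sum zero few of them suffice ([balanced_selection]).
    Choose d of the w_i with maximal absolute determinant: by Cramer's rule
    every w_j is a combination of these with coefficients in [-1, 1].  Adding 1
    to every coefficient makes them nonnegative, at the price of subtracting the
    sum of the chosen vectors.  Because of the balance, minus that sum is the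
    sum of the other N - d vectors, and Caratheodory's theorem for cones
    rewrites it with at most d of them without increasing the total weight N - d
    ([conic_caratheodory]).  So every w_j is a nonnegative combination of at
    most 2d fixed vectors, of total weight at most 2d + (N - d) = N + d.

    It remains to go back and forth between q and w ([steinitz_selection]).
    Since q_i = (1 - <c, q_i>) w_i, a convex combination of the q_i that
    represents x becomes a combination of the w_i of total weight 1 - <c, x>;
    this is at most 2 when |x| <= r, as |<c, x>| <= 1 there.  Conversely
    1 / (1 - <c, q_i>) = 1 + <c, w_i>, so a combination of the w_i of weight s
    that represents x is one of the q_i of weight s + <c, x>.  Hence a vector of
    norm at most r is a combination of the selected q_i of weight at most
    2 (N + d) + 1 <= 5 N, and one of norm at most r / (5 N) has weight at most 1.
    The weight can be raised to 1 as the selected points have 0 in their convex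
    hull. *)

Set Implicit Arguments.
Unset Strict Implicit.
Unset Printing Implicit Defensive.

Import Order.TTheory GRing.Theory Num.Theory.
Import numFieldNormedType.Exports.

Local Open Scope classical_set_scope.
Local Open Scope ring_scope.

(** * Nonnegative combinations of bounded weight *)

(** For t >= 0 this is membership in t * conv({0} u {w i | i in S}); keeping
    the coefficients explicit lets the weights be counted. *)
Definition cone_le (R : realFieldType) (V : lmodType R) (I : finType)
    (w : I -> V) (S : {set I}) (t : R) (x : V) : Prop :=
  exists a : I -> R,
    [/\ forall i, 0 <= a i, forall i, i \notin S -> a i = 0,
        \sum_i a i <= t & \sum_i a i *: w i = x].

Lemma cone_leD (R : realFieldType) (V : lmodType R) (I : finType)
    (w : I -> V) (S T : {set I}) (s t : R) (x y : V) :
  cone_le w S s x -> cone_le w T t y -> cone_le w (S :|: T) (s + t) (x + y).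
Proof.
move=> [a [a0 aS as_ <-]] [b [b0 bT bt <-]]; exists (fun i => a i + b i).
split=> [i|i||].
- exact: addr_ge0.
- by rewrite finset.in_setU negb_or => /andP[/aS-> /bT->]; rewrite addr0.
- by rewrite big_split lerD.
- by rewrite -big_split; apply: eq_bigr => i _; rewrite scalerDl.
Qed.

Lemma cone_leZ (R : realFieldType) (V : lmodType R) (I : finType)
    (w : I -> V) (S : {set I}) (k t : R) (x : V) :
  0 <= k -> cone_le w S t x -> cone_le w S (k * t) (k *: x).
Proof.
move=> k0 [a [a0 aS at_ <-]]; exists (fun i => k * a i).
split=> [i|i /aS->||].
- exact: mulr_ge0.
- by rewrite mulr0.
- by rewrite -mulr_sumr ler_wpM2l.
- by rewrite scaler_sumr; apply: eq_bigr => i _; rewrite scalerA.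
Qed.

Lemma cone_leW (R : realFieldType) (V : lmodType R) (I : finType)
    (w : I -> V) (S : {set I}) (s t : R) (x : V) :
  s <= t -> cone_le w S s x -> cone_le w S t x.
Proof. by move=> st [a [a0 aS /le_trans/(_ st) at_ aw]]; exists a. Qed.

Lemma cone_le_sum (R : realFieldType) (V : lmodType R) (I J : finType)
    (w : I -> V) (S : {set I}) (t : J -> R) (x : J -> V) :
  (forall j, cone_le w S (t j) (x j)) ->
  cone_le w S (\sum_j t j) (\sum_j x j).
Proof.
move=> cx; apply: (big_ind2 (fun x t => cone_le w S t x)) => //.
- exists (fun=> 0); split=> //; first by rewrite big1.
  by rewrite big1// => i _; rewrite scale0r.
- by move=> y s z r cy cz; rewrite -(finset.setUid S); exact: cone_leD.
Qed.

Definition convex_comb (R : realFieldType) (V : lmodType R) (I : finType)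
    (q : I -> V) (S : {set I}) (x : V) : Prop :=
  exists m : I -> R,
    [/\ forall i, 0 <= m i, forall i, i \notin S -> m i = 0,
        \sum_i m i = 1 & \sum_i m i *: q i = x].

(** The missing weight is supplied by a multiple of a nontrivial nonnegative
    relation e, which does not move the point. *)
Lemma cone_le_convex_comb (R : realFieldType) (V : lmodType R) (I : finType)
    (q : I -> V) (S : {set I}) (x : V) (e : I -> R) :
  (forall i, 0 <= e i) -> (forall i, i \notin S -> e i = 0) ->
  0 < \sum_i e i -> \sum_i e i *: q i = 0 ->
  cone_le q S 1 x -> convex_comb q S x.
Proof.
move=> e0 eS e_gt0 eq0 [a [a0 aS a1 ax]].
pose r := (1 - \sum_i a i) / \sum_i e i.
have r0 : 0 <= r by rewrite divr_ge0 ?subr_ge0// ltW.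
exists (fun i => a i + r * e i); split.
- by move=> i; rewrite addr_ge0// mulr_ge0.
- by move=> i iS; rewrite aS// eS// mulr0 addr0.
- by rewrite big_split/= -mulr_sumr divfK ?gt_eqF// subrKC.
- under eq_bigr do rewrite scalerDl -scalerA.
  by rewrite big_split/= -scaler_sumr eq0 scaler0 addr0.
Qed.

(** * Caratheodory's theorem for cones *)

Lemma linear_dependency (F : fieldType) (d : nat) (I : finType)
    (w : I -> 'rV[F]_d) (T : {set I}) :
  (d < #|T|)%N ->
  exists b : I -> F,
    [/\ exists i, b i != 0, forall i, i \notin T -> b i = 0
      & \sum_i b i *: w i = 0].
Proof.
move=> ltdT; pose M := \matrix_(k < #|T|) w (enum_val k).
have /rowV0Pn[v /sub_kermxP vM0 v_neq0] : kermx M != 0.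
  by rewrite kermx_eq0 -row_leq_rank -ltnNge (leq_ltn_trans (rank_leq_col M)).
have [k vk_neq0] : exists k, v 0 k != 0 by apply/rV0Pn.
exists (fun i => \sum_(k < #|T|) v 0 k *+ (enum_val k == i)); split.
- exists (enum_val k); rewrite (bigD1 k)//= eqxx big1 ?addr0// => l lk.
  by rewrite (inj_eq enum_val_inj) (negPf lk).
- move=> i iT; apply: big1 => l _; case: eqP => // lE.
  by rewrite -lE enum_valP in iT.
- transitivity (v *m M); last exact: vM0.
  rewrite mulmx_sum_row; under eq_bigr do rewrite scaler_suml.
  rewrite exchange_big/=; apply: eq_bigr => l _.
  rewrite (bigD1 (enum_val l))//= eqxx rowK big1 ?addr0// => i il.
  by rewrite eq_sym (negPf il) scale0r.
Qed.

(** As long as more than d vectors are used, a multiple of a linear dependency b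
    can be subtracted until a coefficient vanishes.  Choosing the sign of b so
    that its sum is nonnegative ensures that the total weight does not grow. *)
Lemma conic_caratheodory (R : realFieldType) (d : nat) (I : finType)
    (w : I -> 'rV[R]_d) (S : {set I}) (t : R) (x : 'rV[R]_d) :
  cone_le w S t x -> exists2 T : {set I}, (#|T| <= d)%N & cone_le w T t x.
Proof.
elim/ltn_ind: {S}_.+1 {-2}S (ltnSn #|S|) => m IHm S leSm cS.
have [|ltdS] := leqP #|S| d; first by exists S.
have [b [b_neq0 bS bw0 bsum]] : exists b : I -> R,
    [/\ exists i, b i != 0, forall i, i \notin S -> b i = 0,
        \sum_i b i *: w i = 0 & 0 <= \sum_i b i].
  have [b [[i bi] bS bw]] := linear_dependency w ltdS.
  have [b_ge0|b_lt0] := leP 0 (\sum_i b i).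
    by exists b; split=> //; exists i.
  exists (fun i => - b i); split.
  - by exists i; rewrite oppr_eq0.
  - by move=> j /bS->; rewrite oppr0.
  - under eq_bigr do rewrite scaleNr.
    by rewrite sumrN bw oppr0.
  - by rewrite sumrN oppr_ge0 ltW.
have [i1 bi1] : exists i, 0 < b i.
  apply/not_existsP => b_le0; case: b_neq0 => i /eqP; apply.
  have b_le j : b j <= 0 by rewrite leNgt; apply/negP/b_le0.
  have : \sum_j - b j == 0.
    rewrite eq_le sumrN oppr_le0 bsum -sumrN sumr_ge0// => j _.
    by rewrite oppr_ge0.
  rewrite psumr_eq0 => [/allP/(_ i)|j _]; last by rewrite oppr_ge0.
  by rewrite mem_index_enum oppr_eq0 => /(_ isT)/eqP.
case: cS => a [a0 aS asum aw].
pose i0 := [arg min_(i < i1 | 0 < b i) (a i / b i)]%O.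
have [bi0 mini0] : 0 < b i0 /\ forall i, 0 < b i -> a i0 / b i0 <= a i / b i.
  by rewrite /i0; case: arg_minP => // i bi h; split=> // j /h.
have i0S : i0 \in S by apply: contraTT bi0 => /bS->; rewrite ltxx.
(* The largest multiple of b that can be subtracted from a. *)
set r := a i0 / b i0 in mini0.
have r_ge0 : 0 <= r by rewrite divr_ge0// ltW.
apply: (IHm #|S|) (S :\ i0) _ _ => //.
  by rewrite [ltnRHS](cardsD1 i0) i0S add1n.
exists (fun i => a i - r * b i); split.
- move=> i; rewrite subr_ge0; have [bi|bi] := ltP 0 (b i).
    by rewrite -ler_pdivlMr// mini0.
  by rewrite (le_trans _ (a0 i))// mulr_ge0_le0.
- move=> i; rewrite finset.in_setD1 negb_and negbK => /orP[/eqP->|iS].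
    by rewrite /r divfK ?subrr// gt_eqF.
  by rewrite aS// bS// mulr0 subr0.
- rewrite sumrB -mulr_sumr (le_trans _ asum)// gerBl.
  exact: mulr_ge0.
- under eq_bigr do rewrite scalerBl -scalerA.
  by rewrite sumrB -scaler_sumr bw0 scaler0 subr0.
Qed.

(** * Selecting 2d vectors from a balanced family *)

(** Take d of the vectors with the largest absolute determinant.  By Cramer's
    rule the coefficients of w j are quotients of two such determinants, the
    largest one being in the denominator. *)
Lemma max_det_basis (R : realFieldType) (d : nat) (I : finType)
    (w : I -> 'rV[R]_d) :
  (forall x, exists a : I -> R, x = \sum_i a i *: w i) ->
  exists2 f : 'I_d -> I, injective f &
    forall j, exists2 b : 'I_d -> R, forall k, `|b k| <= 1 &
      w j = \sum_k b k *: w (f k).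
Proof.
move=> span; pose M (f : {ffun 'I_d -> I}) := \matrix_(k < d) w (f k).
have [f0 Mf0] : exists f, \det (M f) != 0.
  pose W := \matrix_(i < #|I|) w (enum_val i).
  have Wfull : row_full W.
    rewrite -sub1mx; apply/row_subP => k; have [a ->] := span (row k 1%:M).
    apply: summx_sub => i _; apply: scalemx_sub.
    by rewrite -[i]enum_rankK -(rowK (fun l => w (enum_val l))) row_sub.
  exists [ffun k => enum_val (fullrankfun Wfull k)].
  suff -> : M [ffun k => enum_val (fullrankfun Wfull k)] =
      rowsub (fullrankfun Wfull) W.
    by rewrite -unitfE -unitmxE fullrowsub_unit.
  by apply/matrixP => k l; rewrite !mxE ffunE.
pose f := [arg max_(f > f0) `|\det (M f)|]%O.
have maxf g : `|\det (M g)| <= `|\det (M f)|.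
  by rewrite /f; case: arg_maxP => // h _; apply.
have Mf : \det (M f) != 0.
  by rewrite -normr_gt0 (lt_le_trans _ (maxf f0))// normr_gt0.
exists f => [k l fkl|j].
  apply/eqP; apply: contraNT Mf => kl; apply/eqP.
  by apply: (determinant_alternate kl) => m; rewrite !mxE fkl.
pose b := w j *m invmx (M f).
have bE k : b 0 k = \det (M [ffun l => if l == k then j else f l]) / \det (M f).
  rewrite /b /invmx unitmxE unitfE Mf -scalemxAr mxE mulrC; congr (_ / _).
  rewrite (expand_det_row _ k) mxE; apply: eq_bigr => l _.
  rewrite !mxE ffunE eqxx; congr (_ * (_ * \det _)).
  by apply/matrixP => p q; rewrite !mxE ffunE eq_sym (negPf (neq_lift _ _)).
exists (b 0) => [k|].
  by rewrite bE normrM normfV ler_pdivrMr ?normr_gt0// mul1r maxf.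
have -> : w j = b *m M f by rewrite /b mulmxKV// unitmxE unitfE.
by rewrite mulmx_sum_row; apply: eq_bigr => k _; rewrite rowK.
Qed.

(** The selection consists of a basis B of maximal determinant and of the at
    most d vectors that Caratheodory's theorem keeps in order to represent
    minus the sum of B.  The relation with positive weight shows that 0 is in
    the convex hull of the selected vectors. *)
Lemma balanced_selection (R : realFieldType) (d : nat) (I : finType)
    (w : I -> 'rV[R]_d) :
  (0 < d)%N -> \sum_i w i = 0 ->
  (forall x, exists a : I -> R, x = \sum_i a i *: w i) ->
  exists S : {set I},
    [/\ (#|S| <= 2 * d)%N,
        exists a : I -> R,
          [/\ forall i, 0 <= a i, forall i, i \notin S -> a i = 0,
              0 < \sum_i a i & \sum_i a i *: w i = 0]
      & forall t x, cone_le w [set: I] t x ->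
          cone_le w S (t * (#|I| + d)%:R) x].
Proof.
move=> d_gt0 w0 span; have [f finj fbasis] := max_det_basis span.
pose B := [set f k | k : 'I_d]%SET.
have cardB : #|B| = d by rewrite card_imset// card_ord.
have sumB : \sum_(i in B) w i = \sum_k w (f k).
  by rewrite big_imset//= => k l _ _; exact: finj.
have indicator (A : {set I}) :
    \sum_i (i \in A)%:R *: w i = \sum_(i in A) w i.
  rewrite [RHS]big_mkcond; apply: eq_bigr => i _.
  by case: ifP; rewrite ?scale1r ?scale0r.
have cardE (A : {set I}) : \sum_i (i \in A)%:R = #|A|%:R :> R.
  rewrite -sum1_card natr_sum [RHS]big_mkcond; apply: eq_bigr => i _.
  by case: ifP.
(* By the balance, minus the sum over B is the sum over its complement. *)
have opp_cone : cone_le w (~: B)%SET #|~: B|%SET%:R (- \sum_k w (f k)).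
  exists (fun i => (i \in ~: B)%SET%:R); split.
  - by move=> i; exact: ler0n.
  - by move=> i /negPf->.
  - by rewrite cardE.
  - rewrite indicator -sumB; apply/eqP; rewrite -addr_eq0; apply/eqP.
    rewrite -[RHS]w0 [RHS](bigID (mem B))/= addrC; congr (_ + _).
    by apply: eq_bigl => i; rewrite finset.in_setC.
have [T leTd coneT] := conic_caratheodory opp_cone.
exists (B :|: T)%SET; split.
- by rewrite (leq_trans (leq_card_setU _ _))// cardB mul2n -addnn leq_add2l.
- have [m [m0 mT _ mw]] := coneT.
  exists (fun i => (i \in B)%:R + m i); split.
  + by move=> i; rewrite addr_ge0.
  + move=> i; rewrite finset.in_setU negb_or => /andP[/negPf-> /mT->].
    by rewrite addr0.
  + by rewrite big_split cardE cardB ltr_wpDr ?sumr_ge0 ?ltr0n.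
  + under eq_bigr do rewrite scalerDl.
    by rewrite big_split/= indicator sumB mw subrr.
- have cone_w j : cone_le w (B :|: T)%SET (#|I| + d)%:R (w j).
    have [b b_le ->] := fbasis j.
    (* Shift the coefficients from [-1, 1] to [0, 2]. *)
    have -> : \sum_k b k *: w (f k) =
        \sum_k (b k + 1) *: w (f k) + - \sum_k w (f k).
      by rewrite -sumrB; apply: eq_bigr => k _; rewrite scalerDl scale1r addrK.
    have -> : (#|I| + d)%:R = (2 * d)%:R + #|~: B|%SET%:R :> R.
      by rewrite -natrD; congr _%:R; have := cardsC B; rewrite cardB; lia.
    apply: cone_leD coneT.
    exists (fun i => \sum_k (b k + 1) *+ (f k == i)); split.
    + move=> i; apply: sumr_ge0 => k _; rewrite mulrn_wge0//.
      by have := b_le k; rewrite ler_norml; lra.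
    + move=> i iB; apply: big1 => k _; case: eqP => // fki.
      by rewrite -fki imset_f in iB.
    + rewrite exchange_big/= -[d in (2 * d)%N]card_ord -sum1_card natrM.
      rewrite natr_sum mulr_sumr ler_sum// => k _.
      rewrite (bigD1 (f k))//= eqxx big1 => [|i]; last first.
        by rewrite eq_sym => /negPf->.
      by have := b_le k; rewrite ler_norml mulr1n; lra.
    + under eq_bigr do rewrite scaler_suml.
      rewrite exchange_big/=; apply: eq_bigr => k _.
      rewrite (bigD1 (f k))//= eqxx big1 ?addr0// => i.
      by rewrite eq_sym => /negPf->; rewrite scale0r.
  move=> t x [a [a0 _ at_ <-]].
  apply: (cone_leW (s := \sum_i a i * (#|I| + d)%:R)).
    by rewrite -mulr_suml ler_wpM2r.
  by apply: cone_le_sum => i; exact: cone_leZ.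
Qed.

(** * The analytic center *)

Definition dot (R : comNzRingType) (d : nat) (x y : 'rV[R]_d) : R :=
  \sum_k x 0 k * y 0 k.
Arguments dot {R d} x y.

Section Dot.
Variables (R : comNzRingType) (d : nat).
Implicit Types x y z : 'rV[R]_d.

Lemma dotC x y : dot x y = dot y x.
Proof. by apply: eq_bigr => k _; rewrite mulrC. Qed.

Lemma dotDl x y z : dot (x + y) z = dot x z + dot y z.
Proof. by rewrite -big_split; apply: eq_bigr => k _; rewrite mxE mulrDl. Qed.

Lemma dotZl a x y : dot (a *: x) y = a * dot x y.
Proof. by rewrite mulr_sumr; apply: eq_bigr => k _; rewrite mxE mulrA. Qed.

Lemma dotZr a x y : dot x (a *: y) = a * dot x y.
Proof. by rewrite dotC dotZl dotC. Qed.

Lemma dotNr x y : dot x (- y) = - dot x y.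
Proof. by rewrite -scaleN1r dotZr mulN1r. Qed.

Lemma dot0l y : dot 0 y = 0.
Proof. by rewrite -(scale0r 0) dotZl mul0r. Qed.

Lemma dot_sumr (I : finType) x (a : I -> R) (w : I -> 'rV[R]_d) :
  dot x (\sum_i a i *: w i) = \sum_i a i * dot x (w i).
Proof.
rewrite dotC (big_morph (dot^~ x) (fun y z => dotDl y z x) (dot0l x)).
by apply: eq_bigr => i _; rewrite dotZl dotC.
Qed.

End Dot.

Lemma dot_eq0 (R : realFieldType) (d : nat) (x : 'rV[R]_d) :
  dot x x <= 0 -> x = 0.
Proof.
move=> x0; apply/rowP => k; rewrite mxE; apply/eqP.
have sq0 (l : 'I_d) : true -> 0 <= x 0 l * x 0 l by rewrite -expr2 sqr_ge0.
have : dot x x == 0 by rewrite eq_le x0 sumr_ge0.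
rewrite psumr_eq0// => /allP/(_ k); rewrite mem_index_enum => /(_ isT).
by rewrite mulf_eq0 orbb.
Qed.

Lemma continuous_dot (R : realType) (d : nat) (y : 'rV[R]_d) :
  continuous (fun x : 'rV[R]_d => dot x y).
Proof.
apply: (@continuous_big _ _ +%R 0 xpredT); first exact: add_continuous.
move=> k _ x; apply: continuousM; last exact: cst_continuous.
exact: coord_continuous.
Qed.

Lemma prod_first_order (R : realFieldType) (I : finType) (a : I -> R) :
  exists2 C : R, 0 <= C & forall t, 0 <= t <= 1 ->
    `|\prod_i (1 + t * a i) - 1 - t * \sum_i a i| <= C * t ^+ 2.
Proof.
elim: (index_enum I) => [|i r [C C0 IHr]].
  by exists 0 => // t _; rewrite !big_nil mulr0 subr0 subrr normr0 mul0r.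
set s := \sum_(j <- r) a j in IHr.
exists (C + `|a i| * C + `|a i * s|) => [|t t01].
  by rewrite !addr_ge0// mulr_ge0.
rewrite !big_cons -/s; set p := \prod_(j <- r) _ in IHr *.
have := IHr t t01; set e := p - 1 - t * s => e_le.
have -> : (1 + t * a i) * p - 1 - t * (a i + s) =
    e + t * a i * e + t ^+ 2 * (a i * s) by rewrite /e; ring.
have /andP[t0 t1] := t01.
rewrite (le_trans (ler_normD _ _))// !mulrDl lerD//.
  rewrite (le_trans (ler_normD _ _))// lerD// !normrM (ger0_norm t0) -!mulrA.
  by rewrite (@le_trans _ _ (`|a i| * `|e|))// ?ler_piMl ?ler_wpM2l ?mulr_ge0.
by rewrite normrM (ger0_norm (sqr_ge0 t)) mulrC.
Qed.

(** The first-order optimality condition in one direction: if the sum were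
    positive, the linear term of the product would beat the quadratic error
    for small t. *)
Lemma sum_le0_of_prod_le1 (R : realFieldType) (I : finType) (a : I -> R) :
  (forall t, 0 <= t -> (forall i, 0 <= 1 + t * a i) ->
     \prod_i (1 + t * a i) <= 1) ->
  \sum_i a i <= 0.
Proof.
move=> prod_le1; rewrite leNgt; apply/negP; set s := \sum_i a i => s_gt0.
have [C C0 Ct] := prod_first_order a.
(* Large enough that t := s / D^2 satisfies t <= 1, t |a i| <= 1, C t < s. *)
pose D := 1 + C + \sum_i `|a i| + s.
have na0 : 0 <= \sum_i `|a i| by exact: sumr_ge0.
have D_gt0 : 0 < D by rewrite /D; lra.
set t := s / (D * D).
have t_gt0 : 0 < t by rewrite divr_gt0// mulr_gt0.
have tDD : t * (D * D) = s by rewrite /t divfK// mulf_neq0 ?gt_eqF.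
have tD_lt1 : t * D <= 1.
  by rewrite /t invfM mulrA divfK ?gt_eqF// ler_pdivrMr// /D; lra.
have t_le1 : t <= 1.
  by rewrite (le_trans _ tD_lt1)// ler_peMr ?(ltW t_gt0)// /D; lra.
have ta i : 0 <= 1 + t * a i.
  have aiD : `|a i| <= D.
    have : `|a i| <= \sum_i `|a i| by rewrite (bigD1 i)//= lerDl sumr_ge0.
    by rewrite /D; lra.
  have : `|t * a i| <= 1.
    by rewrite normrM (gtr0_norm t_gt0) (le_trans _ tD_lt1)// ler_wpM2l// ltW.
  by rewrite ler_norml; lra.
have := Ct t; rewrite (ltW t_gt0) t_le1 => /(_ isT).
have := prod_le1 t (ltW t_gt0) ta; set p := \prod_i _ => p_le1.
rewrite ler_norml => /andP[+ _].
have CtD : C * t < s.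
  rewrite -tDD mulrC ltr_pM2l// (@lt_le_trans _ _ D)//.
    by rewrite /D; lra.
  by rewrite ler_peMr ?ltW// /D; lra.
have : t * (C * t) < t * s by rewrite ltr_pM2l.
by rewrite -/s expr2; lra.
Qed.

(** The point c maximises the product of the slacks 1 - <c, q_i> over the polar
    polytope.  At 0 the product is 1, so no slack vanishes at c.  Moving from c
    in the direction opposite to the sum s of the q_i / (1 - <c, q_i>)
    multiplies the product by factors whose first-order terms add up to
    <s, s>, so that maximality forces s = 0. *)
Lemma analytic_center (R : realType) (d : nat) (I : finType)
    (q : I -> 'rV[R]_d) (b : R) :
  (forall c, (forall i, dot c (q i) <= 1) -> forall k, `|c 0 k| <= b) ->
  exists2 c, forall i, dot c (q i) < 1 &
    \sum_i (1 - dot c (q i))^-1 *: q i = 0.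
Proof.
move=> bounded; pose P := [set c | forall i, dot c (q i) <= 1].
have P0 : P 0 by move=> i; rewrite dot0l.
have Pcompact : compact P.
  pose box := [set c : 'rV[R]_d | forall k, `[- b, b]%classic (c ord0 k)].
  have boxc : compact box.
    apply: (@rV_compact _ _ (fun=> `[- b, b]%classic)) => _.
    exact: segment_compact.
  apply: subclosed_compact boxc _ => [|c Pc k]; last first.
    by rewrite /= in_itv/= -ler_norml bounded.
  have -> : P = \bigcap_i (dot^~ (q i) @^-1` [set r | r <= 1]).
    by apply/seteqP; split=> [c Pc i _|c Pc i]; exact: Pc.
  apply: closed_bigI => i _; apply: closed_comp; last exact: closed_le.
  by move=> c _; exact: continuous_dot.
pose f (c : 'rV[R]_d) : R := \prod_i (1 - dot c (q i)).
have fcont : continuous f.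
  have factor_cont i : continuous (fun c : 'rV[R]_d => 1 - dot c (q i) : R^o).
    move=> c; have dot_cont := @continuous_dot _ _ (q i) c.
    exact: (continuousB (@cst_continuous _ R^o 1 c) dot_cont).
  apply: (@continuous_big R^o _ *%R 1 xpredT); first exact: mul_continuous.
  by move=> i _; exact: factor_cont.
have [c /set_mem Pc cmax] := compact_EVT_max (ex_intro _ 0 P0) Pcompact
  (continuous_subspaceT fcont).
have fc_gt0 : 0 < f c.
  rewrite (lt_le_trans ltr01)// (le_trans _ (cmax 0 (mem_set P0)))// /f.
  by rewrite big1// => i _; rewrite dot0l subr0.
have c_lt1 i : dot c (q i) < 1.
  rewrite lt_neqAle Pc andbT; apply: contraTneq fc_gt0 => ci.
  by rewrite /f (bigD1 i)//= ci subrr mul0r ltxx.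
exists c => //; set s := \sum_i _; apply: dot_eq0.
rewrite {2}/s dot_sumr; apply: sum_le0_of_prod_le1 => t t0 t_le.
have stepE i : 1 - dot (c - t *: s) (q i) =
    (1 - dot c (q i)) * (1 + t * ((1 - dot c (q i))^-1 * dot s (q i))).
  rewrite -scaleNr dotDl dotZl; field.
  by rewrite subr_eq0 eq_sym lt_eqF.
have Pstep : P (c - t *: s).
  by move=> i; rewrite -subr_ge0 stepE mulr_ge0// subr_ge0.
have := cmax _ (mem_set Pstep); rewrite {1}/f.
under eq_bigr do rewrite stepE.
by rewrite big_split/= ger_pMr.
Qed.

(** * Convex hulls of finite sets *)

Lemma convex_sum (R : realType) (V : lmodType R) (A : set V) (I : finType)
    (q : I -> V) (m : I -> R) :
  convex_set A -> (forall i, 0 <= m i) -> \sum_i m i = 1 ->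
  (forall i, m i != 0 -> A (q i)) -> A (\sum_i m i *: q i).
Proof.
move=> cA m0 m1 Aq.
(* Normalised partial sums allow an induction on the list of indices. *)
suff H (r : seq I) : 0 < \sum_(i <- r) m i ->
    A ((\sum_(i <- r) m i)^-1 *: \sum_(i <- r) m i *: q i).
  by have := H (index_enum I); rewrite m1 invr1 scale1r; apply.
elim: r => [|i r IHr]; first by rewrite big_nil ltxx.
rewrite !big_cons; have [mi0|mi_neq0] := eqVneq (m i) 0.
  by rewrite mi0 scale0r !add0r.
have r_ge0 : 0 <= \sum_(j <- r) m j by exact: sumr_ge0.
have [r0|r_neq0] := eqVneq (\sum_(j <- r) m j) 0.
  move=> _; rewrite r0 big1_seq ?addr0 => [|j jr]; last first.
    move: r0 => /eqP; rewrite psumr_eq0// => /allP/(_ j jr)/eqP->.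
    by rewrite scale0r.
  by rewrite scalerA mulVf// scale1r; exact: Aq.
set s := \sum_(j <- r) m j in IHr r_ge0 r_neq0 *.
set y := \sum_(j <- r) _ in IHr *.
move=> ms_gt0; have s_gt0 : 0 < s by rewrite lt_def r_neq0.
have p0 : 0 <= m i / (m i + s) by rewrite divr_ge0// ltW.
have p1 : m i / (m i + s) <= 1 by rewrite ler_pdivrMr// mul1r lerDl.
have := cA _ _ (Itv01 p0 p1) (mem_set (Aq i mi_neq0)) (mem_set (IHr s_gt0)).
move/set_mem; congr A; rewrite [LHS]/conv/=.
rewrite scalerDr !scalerA; congr (_ *: _ + _ *: _); first by rewrite mulrC.
by rewrite /unstable.onem; field; rewrite r_neq0 gt_eqF.
Qed.

Lemma convex_hull_comb (R : realType) (d : nat) (Q : {fset 'rV[R]_d})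
    (x : 'rV[R]_d) :
  convex_hull [set` Q] x -> convex_comb (fun i : Q => val i) [set: Q] x.
Proof.
apply; split=> [y z p|y /= yQ].
  move=> /set_mem[m [m0 _ m1 <-]] /set_mem[n [n0 _ n1 <-]]; apply/mem_set.
  have p1 : 0 <= 1 - p%:num by rewrite subr_ge0.
  exists (fun i => p%:num * m i + (1 - p%:num) * n i); split.
  - by move=> i; rewrite addr_ge0// mulr_ge0.
  - by move=> i; rewrite finset.in_setT.
  - by rewrite big_split/= -!mulr_sumr m1 n1 !mulr1 subrKC.
  - rewrite [RHS]/conv/= !scaler_sumr -big_split; apply: eq_bigr => i _.
    by rewrite !scalerA scalerDl.
exists (fun i => (i == [` yQ]%fset)%:R); split.
- by move=> i; exact: ler0n.
- by move=> i; rewrite finset.in_setT.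
- by rewrite (bigD1 [` yQ]%fset)//= eqxx big1 ?addr0// => i /negPf->.
- rewrite (bigD1 [` yQ]%fset)//= eqxx big1 ?addr0 ?scale1r// => i /negPf->.
  by rewrite scale0r.
Qed.

Lemma convex_comb_hull (R : realType) (d : nat) (Q : {fset 'rV[R]_d})
    (S : {set Q}) (x : 'rV[R]_d) :
  convex_comb (fun i : Q => val i) S x ->
  convex_hull [set` [fset val i | i in S]%fset] x.
Proof.
move=> [m [m0 mS m1 <-]] A [cA SA]; apply: convex_sum => // i mi; apply: SA.
rewrite /=; apply/imfsetP; exists i => //=.
by apply: contraNT mi => /mS->.
Qed.

(** * Euclidean balls *)

Lemma enormZ (R : realType) (d : nat) (a : R) (x : 'rV[R]_d) :
  enorm (a *: x) = `|a| * enorm x.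
Proof.
rewrite /enorm -sqrtr_sqr -sqrtrM ?sqr_ge0// mulr_sumr.
by congr Num.sqrt; apply: eq_bigr => k _; rewrite mxE exprMn.
Qed.

Lemma enorm_delta (R : realType) (d : nat) (k : 'I_d) :
  enorm (delta_mx 0 k : 'rV[R]_d) = 1.
Proof.
rewrite /enorm (bigD1 k)//= mxE !eqxx expr1n big1 ?addr0 ?sqrtr1// => l lk.
by rewrite mxE (negPf lk) andbF expr0n.
Qed.

Lemma dilate_unit_ball (R : realType) (d : nat) (t : R) (x : 'rV[R]_d) :
  0 < t -> dilate t (@unit_ball R d) x <-> enorm x <= t.
Proof.
move=> t_gt0; split=> [[y y1 <-]|xt].
  by rewrite enormZ gtr0_norm// ler_piMr// ltW.
exists (t^-1 *: x); last by rewrite scalerA divff ?scale1r// gt_eqF.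
by rewrite /unit_ball/= enormZ gtr0_norm ?invr_gt0// ler_pdivrMl// mulr1.
Qed.

(** A linear functional bounded by 1 at the points is bounded by 1 on their
    convex hull, and the ball is symmetric. *)
Lemma dot_ball_le1 (R : realType) (d : nat) (I : finType)
    (q : I -> 'rV[R]_d) (r : R) :
  (forall x, enorm x <= r -> convex_comb q [set: I] x) ->
  forall c, (forall i, dot c (q i) <= 1) ->
  forall x, enorm x <= r -> `|dot c x| <= 1.
Proof.
move=> ball c c1.
have le1 x : enorm x <= r -> dot c x <= 1.
  move=> /ball[m [m0 _ m1 <-]]; rewrite dot_sumr -m1.
  by apply: ler_sum => i _; rewrite ler_piMr.
move=> x xr; rewrite ler_norml le1// andbT lerNl -dotNr le1//.
by rewrite -scaleN1r enormZ normrN1 mul1r.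
Qed.

(** * The quantitative Steinitz theorem *)

(** The selection is made on the balanced multiples w i of the points, and the
    weights are converted between the two families in both directions. *)
Lemma steinitz_selection (R : realType) (d : nat) (I : finType)
    (q : I -> 'rV[R]_d) (r : R) :
  (0 < d)%N -> (d <= #|I|)%N -> 0 < r ->
  (forall x, enorm x <= r -> convex_comb q [set: I] x) ->
  exists2 S : {set I}, (#|S| <= 2 * d)%N &
    forall x, enorm x <= r / (5 * #|I|%:R) -> convex_comb q S x.
Proof.
move=> d_gt0 ledN r_gt0 ball; have dot_le1 := dot_ball_le1 ball.
have bounded c : (forall i, dot c (q i) <= 1) -> forall k, `|c 0 k| <= r^-1.
  move=> c1 k; have := dot_le1 c c1 (r *: delta_mx 0 k).
  rewrite enormZ enorm_delta mulr1 gtr0_norm// => /(_ (lexx r)).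
  rewrite dotZr (_ : dot c _ = c 0 k); last first.
    rewrite /dot (bigD1 k)//= mxE !eqxx mulr1 big1 ?addr0// => l lk.
    by rewrite mxE (negPf lk) andbF mulr0.
  by rewrite normrM gtr0_norm// -ler_pdivlMl// mulr1.
have [c c_lt1 w_sum0] := analytic_center bounded.
have c_dot x : enorm x <= r -> `|dot c x| <= 1.
  by apply: dot_le1 => i; exact: ltW.
pose g i := 1 - dot c (q i); pose w i := (g i)^-1 *: q i.
have g_gt0 i : 0 < g i by rewrite subr_gt0.
have qE i : q i = g i *: w i by rewrite scalerA divff ?scale1r// gt_eqF.
(* The weight of q i when it stands for w i. *)
have giE i : (g i)^-1 = 1 + dot c (w i).
  by rewrite dotZr -[1 in RHS](mulVf (lt0r_neq0 (g_gt0 i))) -mulrDr subrK mulr1.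
(* From q to w: the total weight becomes 1 - <c, x>. *)
have cone2 x : enorm x <= r -> cone_le w [set: I] 2 x.
  move=> xr; have [m [m0 _ m1 mx]] := ball x xr.
  exists (fun i => m i * g i); split.
  - by move=> i; rewrite mulr_ge0// ltW.
  - by move=> i; rewrite finset.in_setT.
  - under eq_bigr do rewrite mulrBr mulr1.
    rewrite sumrB m1 -dot_sumr mx.
    by have := c_dot x xr; rewrite ler_norml; lra.
  - by rewrite -mx; apply: eq_bigr => i _; rewrite -scalerA -qE.
have span x : exists a : I -> R, x = \sum_i a i *: w i.
  have e1_gt0 : 0 < enorm x + 1 by rewrite ltr_wpDl// sqrtr_ge0.
  have [|a [_ _ _ ax]] := cone2 ((r / (enorm x + 1)) *: x).
    rewrite enormZ gtr0_norm ?divr_gt0// mulrAC ler_pdivrMr//.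
    by rewrite ler_pM2l// lerDl.
  exists (fun i => (enorm x + 1) / r * a i).
  under eq_bigr do rewrite -scalerA.
  rewrite -scaler_sumr ax scalerA mulrA divfK ?gt_eqF// divff ?scale1r//.
  by rewrite gt_eqF.
have [S [leS [z [z0 zS z_gt0 zw]] coneS]] :=
  balanced_selection d_gt0 w_sum0 span.
exists S => // x xr.
have N_gt0 : 0 < #|I|%:R :> R by rewrite ltr0n (leq_trans d_gt0).
apply: (@cone_le_convex_comb _ _ _ _ _ _ (fun i => z i / g i)).
- by move=> i; rewrite divr_ge0// ltW.
- by move=> i /zS->; rewrite mul0r.
- under eq_bigr do rewrite giE mulrDr mulr1.
  by rewrite big_split/= -dot_sumr zw dotC dot0l addr0.
- by rewrite -[RHS]zw; apply: eq_bigr => i _; rewrite scalerA.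
set k := 5 * #|I|%:R in xr *.
have k_gt0 : 0 < k by rewrite mulr_gt0.
have kxr : enorm (k *: x) <= r.
  by rewrite enormZ gtr0_norm// mulrC -ler_pdivlMr.
have [a [a0 aS ale ax]] := coneS _ _ (cone2 _ kxr).
exists (fun i => k^-1 * (a i / g i)); split.
- by move=> i; rewrite !mulr_ge0 ?invr_ge0// ltW.
- by move=> i /aS->; rewrite mul0r mulr0.
- rewrite -mulr_sumr ler_pdivrMl// mulr1.
  (* 2 (N + d) + 1 <= 5 N because d <= N and 1 <= N. *)
  under eq_bigr do rewrite giE mulrDr mulr1.
  rewrite big_split/= -dot_sumr ax.
  have : `|dot c (k *: x)| <= 1 by exact: c_dot.
  have : d%:R <= #|I|%:R :> R by rewrite ler_nat.
  have : 1 <= #|I|%:R :> R by rewrite ler1n (leq_trans d_gt0).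
  by move: ale; rewrite ler_norml natrD /k; lra.
- transitivity (k^-1 *: (k *: x)); last first.
    by rewrite scalerA mulVf ?scale1r// gt_eqF.
  rewrite -ax scaler_sumr; apply: eq_bigr => i _.
  by rewrite !scalerA mulrA.
Qed.

Theorem corollary1p3 (R : realType) (d : nat) (hd : (0 < d)%N)
    (lambda alpha : R) (hlambda : 0 < lambda) (halpha : 1 < alpha)
    (Q : {fset 'rV[R]_d}) (hcard : #|` Q|%:R = alpha * d%:R)
    (hball : dilate lambda (@unit_ball R d) `<=` convex_hull [set` Q]) :
  exists P : {fset 'rV[R]_d},
    [/\ (P `<=` Q)%fset,
        (#|` P| <= 2 * d)%N
      & dilate (lambda / (5 * alpha * d%:R)) (@unit_ball R d)
          `<=` convex_hull [set` P]].
Proof.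
have d_gt0 : 0 < d%:R :> R by rewrite ltr0n.
have leN : (d <= #|{: Q}|)%N.
  by rewrite -cardfE -(ler_nat R) hcard ler_peMl ?ltW.
have ball x : enorm x <= lambda -> convex_comb (fun i : Q => val i) [set: Q] x.
  by move=> xl; apply: convex_hull_comb; apply: hball; apply/dilate_unit_ball.
have [S leS Sball] := steinitz_selection hd leN hlambda ball.
exists [fset val i | i in S]%fset; split.
- by apply/fsubsetP => x /imfsetP[i _ ->]; exact: valP.
- by rewrite (leq_trans (leq_imfset_card _ _ _))//= -cardE.
- move=> x; rewrite -mulrA -hcard cardfE dilate_unit_ball => [/Sball|].
    exact: convex_comb_hull.
  by rewrite divr_gt0// mulr_gt0// ltr0n (leq_trans hd).
Qed.
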